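(* Let $p$ be an odd prime, let $G$ be a finite $p$-group, and let $A$ be a finite $p$-group acting on $G$ by automorphisms. Then there exists an $A$-subgroup $K\leq G$ such that $d(K)=d(G)$, $K$ has nilpotency class $\leq 2$, and $\gamma_2(K)=\Phi(K)$.
   Context: All groups are finite. For a finite $p$-group $G$, $d(G)$ denotes the minimal number of generators of $G$, $\Phi(G)$ its Frattini subgroup, and $\gamma_2(G)=[G,G]$ its derived subgroup. If a group $A$ acts on $G$ (by automorphisms), an $A$-subgroup of $G$ is a subgroup of $G$ which is $A$-invariant. *)

(* Defs.v *)
From mathcomp Require Import all_boot all_fingroup all_solvable.

(* Main.v *)
Require Import Defs.
From mathcomp Require Import all_boot all_fingroup all_solvable.

(** Work inside the semidirect product of [G] and [A], and let [K] be minimal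
    among the [A]-subgroups of [G] with [d(K) >= d(G)].  As [d] drops by at
    most one on an [A]-subgroup of index [p], [d(K) = d(G)].  The preimage of
    [Omega_1(K / K')] has at least [d(K)] generators, so it is [K], whence
    [Phi(K) = K'].  If [K] had class greater than 2, dividing by a normal
    [A]-subgroup [N] of index [p] in [gamma_3(K)] would give a group [Q] with
    [gamma_3(Q)] central of order [p].  Put [C = C_Q(Q')].  The commutator
    pairing [Q / C * Q' / (Q' :&: Z(Q)) -> gamma_3(Q)] gives
    [|Q : C| <= |Q' : Q' :&: Z(Q)|], while [Q' <= C] and [Phi(C) <= Z(Q)]
    (this is where [p] is odd).  Hence
    [|Q : Phi(Q)| = |Q : C| |C : Q'| <= |C : Phi(C)|], so [d(Q) <= d(C)], and
    the preimage of [C] contradicts the minimality of [K]. *)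

Set Implicit Arguments.
Unset Strict Implicit.
Unset Printing Implicit Defensive.
Local Open Scope group_scope.

(** * Generator number under quotients and on subgroups of index p *)

Lemma grank_quotient_lift (gT : finGroupType) (G N : {group gT}) :
  N <| G -> exists B : {set gT},
    [/\ B \subset G, N <*> B = G & #|B| <= 'm(G / N)].
Proof.
move=> nsNG; have [Xb genX cardX] := grank_witness (G / N).
have sXG: Xb \subset G / N by rewrite -genX subset_gen.
pose B := [set repr xb | xb : coset_of N in Xb].
have sBN: B \subset 'N(N).
  by apply/subsetP=> _ /imsetP[xb _ ->]; apply: repr_coset_norm.
have BX: B / N = Xb.
  rewrite /quotient morphimEsub //= -imset_comp -[RHS]imset_id.
  by apply: eq_in_imset => xb _ /=; rewrite coset_reprK.
have sBG: B \subset G.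
  by rewrite -(quotientGK nsNG) -sub_quotient_pre // BX.
exists B; split=> //; last by rewrite -cardX leq_imset_card.
apply/eqP; rewrite eqEsubset join_subG normal_sub //= sBG /=.
rewrite -(quotientSGK (normal_norm nsNG)) ?joing_subl //=.
by rewrite -genX gen_subG -BX quotientS ?joing_subr.
Qed.

Lemma grank_quotient_Phi (gT : finGroupType) (G N : {group gT}) :
  N <| G -> N \subset 'Phi(G) -> 'm(G / N) = 'm(G).
Proof.
move=> nsNG sNPhi; apply/eqP; rewrite eqn_leq quotient_grank ?normal_norm //=.
have [B [sBG genB leB]] := grank_quotient_lift nsNG.
apply: leq_trans leB; rewrite -[X in 'm(X)](_ : <<B>> = G) ?grank_min //.
apply: Phi_nongen; apply/eqP; rewrite eqEsubset join_subG Phi_sub sBG /=.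
by rewrite -{1}genB genS // setSU.
Qed.

Lemma grank_logn_Phi (gT : finGroupType) (p : nat) (G : {group gT}) :
  p.-group G -> 'm(G) = logn p #|G : 'Phi(G)|.
Proof.
move=> pG; have abelGPhi := Phi_quotient_abelem pG.
rewrite -(grank_quotient_Phi (Phi_normal G)) // grank_abelian; last first.
  exact: abelem_abelian abelGPhi.
by rewrite (rank_abelem abelGPhi) card_quotient ?gFnorm.
Qed.

Lemma grank_prime_index (gT : finGroupType) (G M : {group gT}) :
  M \subset G -> prime #|G : M| -> 'm(G) <= 'm(M).+1.
Proof.
move=> sMG prM; have maxM := p_index_maximal sMG prM.
have [B genB cardB] := grank_witness M.
have /properP[_ [x Gx notMx]] := maxgroupp maxM.
have sMH: M \subset <<x |: B>> by rewrite -genB genS ?subsetUr.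
have defG: <<x |: B>> = G.
  have [_ maxM'] := maxgroupP maxM.
  have: <<x |: B>> \subset G.
    by rewrite gen_subG subUset sub1set Gx -gen_subG genB.
  rewrite subEproper => /predU1P[-> // | /maxM'/(_ sMH) defM].
  by case/negP: notMx; rewrite -defM mem_gen ?setU11.
rewrite -defG (leq_trans (grank_min _)) // cardsU1 -cardB.
by rewrite -add1n leq_add2r leq_b1.
Qed.

(** * Centraliser of G' when the third lower central term has order p *)

Lemma index_subcent_leq (gT : finGroupType) (n : nat) (G : {group gT})
    (B : {set gT}) :
  {in B, forall b, #|b ^: G| <= n} -> #|G : 'C_G(B)| <= (n ^ #|B|)%N.
Proof.
move cardB: #|B| => m; elim: m B cardB => [|m IHm] B cardB leB.
  by rewrite (cards0_eq cardB) expn0 (setIidPl _) ?indexgg // centsC sub0set.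
have /set0Pn[b Bb]: B != set0 by rewrite -card_gt0 cardB.
rewrite (cardsD1 b) Bb in cardB; case: cardB => cardB.
have leBm := IHm _ cardB (fun c Bc => leB c (subsetP (subsetDl _ _) c Bc)).
rewrite -(setD1K Bb) setUC centU cent_set1 setIA.
(* Peel off [b]: its centraliser in ['C_G(B :\ b)] has as index the size of a class contained in
   [b ^: G]. *)
rewrite -(Lagrange_index (subsetIl G 'C(B :\ b))) ?subsetIl //=.
rewrite expnS mulnC leq_mul //.
rewrite index_cent1 (leq_trans _ (leB b Bb)) // subset_leq_card //.
by rewrite imsetS ?subsetIl.
Qed.

Lemma lcn3_prime_central (gT : finGroupType) (p : nat) (G : {group gT}) :
  prime p -> p.-group G -> #|'L_3(G)| = p -> 'L_3(G) \subset 'Z(G).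
Proof.
move=> p_pr pG cardL; rewrite subsetI lcn_sub /=; apply/commG1P.
have ntL: 'L_3(G) != 1.
  by rewrite -cardG_gt1 cardL prime_gt1.
have prL: [~: 'L_3(G), G] \proper 'L_3(G).
  rewrite (nil_comm_properl (pgroup_nil pG)) ?lcn_sub //.
  by rewrite subsetI subxx lcn_norm.
apply/card_le1_trivg.
have [_ /(_ _ (cardSg (proper_sub prL)))] :=
  primeP (etrans (congr1 prime cardL) p_pr).
by case/orP=> /eqP cardLG; last move: (proper_card prL); rewrite cardLG ?ltnn.
Qed.

(* Write [u = [g, c]], which commutes with [c], and [z = [u, g]], which is
   central of order dividing [p].  Then
   [(g ^+ p) ^ c = (g * u) ^+ p = g ^+ p * u ^+ p * z ^+ 'C(p, 2)],
   where [p %| 'C(p, 2)] as [p] is odd; since [c] centralises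
   [g ^+ p \in 'Phi(G)], this gives [u ^+ p = 1], that is [c ^+ p] commutes
   with [g]. *)
Lemma expg_cent_der1 (gT : finGroupType) (p : nat) (G : {group gT}) (c : gT) :
    prime p -> odd p -> p.-group G -> 'Phi(G) = G^`(1) ->
    'L_3(G) \subset 'Z(G) -> exponent 'L_3(G) %| p ->
  c \in 'C_G(G^`(1)) -> c ^+ p \in 'Z(G).
Proof.
move=> p_pr p_odd pG PhiG sLZ expL /setIP[Gc cDc].
apply/centerP; split=> [|g Gg]; first exact: groupX.
have Dgp: g ^+ p \in G^`(1).
  rewrite -PhiG (Phi_joing pG) mem_gen // inE.
  by rewrite (Mho_p_elt 1) ?orbT ?(mem_p_elt pG).
pose u := [~ g, c]; pose z := [~ u, g].
have Du: u \in G^`(1) by apply: mem_commg.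
have Lz: z \in 'L_3(G) by apply: mem_commg.
have /setIP[_ cGz]: z \in 'Z(G) := subsetP sLZ z Lz.
have zp: z ^+ p = 1 by apply: (exponentP expL).
have Gu: u \in G by apply: groupR.
have up: u ^+ p = 1.
  have cuz: commute u z := commute_sym (centP cGz u Gu).
  have cgz: commute g z := commute_sym (centP cGz g Gg).
  have [k defk] : exists k, 'C(p, 2) = (p * k)%N.
    have /dvdnP[k ->]: p %| 'C(p, 2) by rewrite prime_dvd_bin ?odd_prime_gt2.
    by exists k; rewrite mulnC.
  have := expMg_Rmul p cuz cgz; rewrite -/z defk expgM zp expg1n mulg1.
  rewrite -[g * u]conjg_mulR -conjXg {1}/conjg -(centP cDc _ Dgp) mulKg.
  by rewrite -{1}[g ^+ p]mulg1 => /mulgI.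
have cuc: commute c [~ c, g].
  by rewrite -invg_comm -/u; apply/commuteV; apply: (centP cDc).
apply/commgP; rewrite commXg // -invg_comm -/u expgVn.
by rewrite up invg1.
Qed.

Lemma class_subset_lcoset (gT : finGroupType) (G : {group gT}) (b : gT)
    (H : {set gT}) :
  {in G, forall g, [~ b, g] \in H} -> b ^: G \subset b *: H.
Proof.
move=> sbH; apply/subsetP=> _ /imsetP[g Gg ->].
by rewrite conjg_mulR mem_lcoset mulKg sbH.
Qed.

(** Counting replaces the pairing: lifts [B] of a minimal generating set of G'/Z have the same
    centraliser as G', since [Z] is central, and each class [b ^: G] lies in a coset of ['L_3(G)],
    hence has at most p elements. *)
Lemma index_cent_der1_leq (gT : finGroupType) (p : nat) (G Z : {group gT}) :
    p.-group G -> #|'L_3(G)| = p -> Z \subset 'Z(G) -> Z <| G^`(1) ->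
    p.-abelem (G^`(1) / Z) ->
  #|G : 'C_G(G^`(1))| <= #|G^`(1) : Z|.
Proof.
move=> pG cardL sZZ nsZD abelDZ.
have [B [sBD genB cardB]] := grank_quotient_lift nsZD.
have ->: 'C_G(G^`(1)) = 'C_G(B).
  apply/eqP; rewrite eqEsubset setIS ?centS //= subsetI subsetIl /=.
  rewrite -genB cent_gen centU subsetI subsetIr andbT.
  by rewrite subIset // centsC (subset_trans sZZ) ?subsetIr.
apply: (@leq_trans (p ^ #|B|)%N).
  apply: index_subcent_leq => b Bb; rewrite -cardL -(card_lcoset _ b).
  apply: subset_leq_card; apply: class_subset_lcoset => g Gg.
  exact: mem_commg (subsetP sBD b Bb) Gg.
rewrite -card_quotient ?normal_norm // (card_pgroup (abelem_pgroup abelDZ)).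
rewrite -(rank_abelem abelDZ) -(grank_abelian (abelem_abelian abelDZ)).
rewrite leq_pexp2l //.
by rewrite -cardL cardG_gt0.
Qed.

Lemma grank_cent_der1 (gT : finGroupType) (p : nat) (G : {group gT}) :
    prime p -> odd p -> p.-group G -> 'Phi(G) = G^`(1) -> #|'L_3(G)| = p ->
  'm(G) <= 'm('C_G(G^`(1))).
Proof.
move=> p_pr p_odd pG PhiG cardL.
have sLZ := lcn3_prime_central p_pr pG cardL.
have cLG: [~: 'L_3(G), G] = 1.
  by apply/commG1P; rewrite (subset_trans sLZ) ?subsetIr.
set C := 'C_G(_).
have pC: p.-group C := pgroupS (subsetIl _ _) pG.
have sDC: G^`(1) \subset C.
  rewrite subsetI der_sub; apply/commG1P.
  apply: three_subgroup => //.
  by rewrite [[~: _, G^`(1)]]commGC.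
have cDC: [~: G^`(1), C] = 1 by apply/commG1P; rewrite centsC subsetIr.
have sC'Z: C^`(1) \subset 'Z(G).
  rewrite subsetI (subset_trans (der_sub _ _)) ?subsetIl //=.
  (* [G, C] lies in G', which [C] centralises; the three subgroups lemma then kills [C, C, G]. *)
  have cGCC: [~: G, C, C] = 1.
    by apply/trivgP; rewrite -cDC !commSg ?commgS ?subsetIl.
  apply/commG1P/three_subgroup => //.
  by rewrite [[~: C, G]]commGC.
have expCZ c: c \in C -> c ^+ p \in 'Z(G).
  by apply: expg_cent_der1 => //; rewrite -cardL exponent_dvdn.
pose Z := (G^`(1) :&: 'Z(G))%G.
have nsZD: Z <| G^`(1).
  apply: (normalS (subsetIl _ _) (der_sub 1 G)).
  by rewrite normalI ?der_normal ?center_normal.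
have abelDZ: p.-abelem (G^`(1) / Z).
  apply/abelemP=> //; split.
    by rewrite quotient_abelian // (sameP derG1P commG1P) (subset_trans sDC) ?subsetIr.
  move=> _ /morphimP[d nZd Dd ->]; rewrite -morphX //; apply: coset_id.
  by rewrite inE groupX // expCZ // (subsetP sDC).
have sPhiZ: 'Phi(C) \subset Z.
  rewrite /= subsetI -{1}PhiG (PhiS pG) ?subsetIl //=.
  rewrite (Phi_joing pC) join_subG sC'Z (MhoE 1 pC) gen_subG.
  by apply/subsetP=> _ /imsetP[c Cc ->]; apply: expCZ.
rewrite (grank_logn_Phi pG) (grank_logn_Phi pC) PhiG.
have /p_natP[m defm]: p.-nat #|G : G^`(1)| := pnat_dvd (dvdn_indexg _ _) pG.
have /p_natP[n defn]: p.-nat #|C : 'Phi(C)| := pnat_dvd (dvdn_indexg _ _) pC.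
rewrite defm defn !pfactorK // -(leq_exp2l _ _ (prime_gt1 p_pr)) -defm -defn.
apply: (@leq_trans #|C : Z|); last by rewrite dvdn_leq ?indexg_gt0 ?indexgS.
(* Split |G : G'| at [C] and |C : Z| at G'; the factor |C : G'| cancels. *)
rewrite -(Lagrange_index (subsetIl G 'C(G^`(1)))) //.
rewrite -(Lagrange_index sDC (normal_sub nsZD)) mulnC leq_mul2l orbC.
by rewrite (index_cent_der1_leq pG) ?subsetIr.
Qed.

(** * Invariant subgroups and minimality for the generator number *)

Lemma exists_norm_grank_leqS (p : nat) (gT : finGroupType) (K B : {group gT}) :
    p.-group K -> p.-group B -> B \subset 'N(K) -> K :!=: 1 ->
  exists H : {group gT}, [/\ H \proper K, B \subset 'N(H) & 'm(K) <= 'm(H).+1].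
Proof.
move=> pK pB nKB ntK.
have pP: p.-group (B <*> K) by rewrite norm_joinEl // pgroupM pB.
have nsKP: K <| B <*> K by rewrite /normal joing_subr join_subG nKB normG.
have [p_pr _ [n cardK]] := pgroup_pdiv pK ntK.
(* Normality in the p-group [B <*> K] makes the subgroup of index p invariant under [B]. *)
have [|H [sHK nsHP cardH]] := @normal_pgroup p gT n (B <*> K) K pP nsKP.
  by rewrite cardK pfactorK.
have iHK: #|K : H| = p.
  by rewrite -divgS // cardK cardH expnS mulnK // expn_gt0 prime_gt0.
exists H; split; last by rewrite grank_prime_index ?iHK.
  by rewrite properE sHK -indexg_gt1 iHK prime_gt1.
by case/andP: nsHP => _; rewrite join_subG => /andP[].
Qed.

Section GrankMinimal.

Variables (p : nat) (gT : finGroupType) (K B : {group gT}).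
Hypotheses (p_pr : prime p) (p_odd : odd p) (pK : p.-group K) (pB : p.-group B).
Hypotheses (nKB : B \subset 'N(K)).
Hypothesis minK : forall H : {group gT},
  H \subset K -> B \subset 'N(H) -> 'm(K) <= 'm(H) -> H :=: K.

Lemma grank_minimal_Phi : 'Phi(K) = K^`(1).
Proof.
have sDPhi: K^`(1) \subset 'Phi(K) by rewrite (Phi_joing pK) joing_subl.
apply/eqP; rewrite eqEsubset sDPhi andbT.
have nDK: K \subset 'N(K^`(1)) := der_norm 1 K.
have nDB: B \subset 'N(K^`(1)) := gFnorm_trans _ nKB.
pose W := 'Ohm_1(K / K^`(1)).
have abKD: abelian (K / K^`(1)) := der_abelian 0 K.
have pKD: p.-group (K / K^`(1)) := quotient_pgroup _ pK.
have sHK: coset K^`(1) @*^-1 W \subset K.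
  by rewrite sub_cosetpre_quo ?Ohm_sub ?der_normal.
have nHB: B \subset 'N(coset K^`(1) @*^-1 W).
  by rewrite norm_quotient_pre // gFnorm_trans ?quotient_norms.
have mHK: 'm(K) <= 'm(coset K^`(1) @*^-1 W).
  (* d(K) = d(K/K') because K' lies in ['Phi(K)], and the abelian group K/K' has the same rank as
     [W]. *)
  apply: (@leq_trans 'm(W)); last first.
    by rewrite -[X in 'm(X) <= _](cosetpreK W) quotient_grank ?subsetIl.
  rewrite -(grank_quotient_Phi (der_normal 1 K)) // !grank_abelian ?rank_Ohm1 //.
  exact: abelianS (Ohm_sub 1 _) abKD.
have defK := minK sHK nHB mHK.
apply: (Phi_min pK nDK).
by rewrite -defK cosetpreK Ohm1_abelem.
Qed.

Lemma grank_minimal_lcn3 : 'L_3(K) = 1.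
Proof.
have nLB: B \subset 'N('L_3(K)) := gFnorm_trans _ nKB.
apply/eqP/negPn/negP => ntL.
have pP: p.-group (B <*> K) by rewrite norm_joinEl // pgroupM pB.
have nsLP: 'L_3(K) <| B <*> K.
  rewrite /normal join_subG nLB lcn_norm andbT.
  by rewrite (subset_trans (lcn_sub _ _)) ?joing_subr.
have [pL _ [n cardL]] := pgroup_pdiv (pgroupS (lcn_sub 3 K) pK) ntL.
have [|N [sNL nsNP cardN]] := @normal_pgroup p gT n (B <*> K) 'L_3(K) pP nsLP.
  by rewrite cardL pfactorK.
have /andP[_] := nsNP; rewrite join_subG => /andP[nNB nNK].
have sLD: 'L_3(K) \subset K^`(1) := lcn_sub_leq K (isT : 2 <= 3).
have sNPhi: N \subset 'Phi(K) by rewrite grank_minimal_Phi (subset_trans sNL).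
have nsNK: N <| K by rewrite /normal nNK (subset_trans sNPhi) ?Phi_sub.
pose Q := (K / N)%G.
have pQ: p.-group Q := quotient_pgroup _ pK.
have PhiQ: 'Phi(Q) = Q^`(1).
  by rewrite -(quotient_Phi pK) // grank_minimal_Phi quotient_der.
have cardLQ: #|'L_3(Q)| = p.
  rewrite -morphim_lcn // card_quotient; last first.
    by rewrite (subset_trans (lcn_sub _ _)).
  by rewrite -divgS // cardL cardN expnS mulnK // expn_gt0 prime_gt0.
pose C := 'C_Q(Q^`(1)).
have sHK: coset N @*^-1 C \subset K.
  by rewrite sub_cosetpre_quo ?subsetIl.
have chC: C \char Q by rewrite subcent_char ?char_refl ?der_char.
have nHB: B \subset 'N(coset N @*^-1 C).
  by rewrite norm_quotient_pre // (char_norm_trans chC) ?quotient_norms.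
have mHK: 'm(K) <= 'm(coset N @*^-1 C).
  (* d(K) = d(Q) because [N] lies in ['Phi(K)]. *)
  apply: (@leq_trans 'm(C)); last first.
    by rewrite -[X in 'm(X) <= _](cosetpreK C) quotient_grank ?subsetIl.
  by rewrite -(grank_quotient_Phi nsNK) // (grank_cent_der1 p_pr).
have defK := minK sHK nHB mHK.
have defQ: C = Q by rewrite /Q /= -defK cosetpreK.
have: 'L_3(Q) = 1 by apply/commG1P; rewrite centsC -{1}defQ subsetIr.
by move=> L1; move: (prime_gt1 p_pr); rewrite -cardLQ L1 cards1.
Qed.

End GrankMinimal.

Lemma exists_norm_grank_eq_class2 (p : nat) (gT : finGroupType)
    (G B : {group gT}) :
    prime p -> odd p -> p.-group G -> p.-group B -> B \subset 'N(G) ->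
  exists K : {group gT},
    [/\ K \subset G, B \subset 'N(K), 'm(K) = 'm(G),
        nil_class K <= 2 & K^`(1) = 'Phi(K)].
Proof.
move=> p_pr p_odd pG pB nGB.
(* With an inequality here, every invariant subgroup of [K] with at least d(K) generators competes
   in [minK']. *)
pose gP (H : {group gT}) := [&& H \subset G, B \subset 'N(H) & 'm(G) <= 'm(H)].
have [|K /mingroupP[/and3P[sKG nKB mGK] minK] _] := @mingroup_exists _ gP G.
  by rewrite /gP subxx nGB leqnn.
have pK := pgroupS sKG pG.
have minK' (H : {group gT}) :
  H \subset K -> B \subset 'N(H) -> 'm(K) <= 'm(H) -> H :=: K.
  move=> sHK nHB mKH; apply: minK => //.
  by rewrite /gP (subset_trans sHK) // nHB (leq_trans mGK).
exists K; split=> //.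
- apply/eqP; rewrite eqn_leq mGK andbT.
  have [-> | ntK] := eqVneq (K : {set gT}) 1.
    by rewrite -gen0 (leq_trans (grank_min _)) ?cards0.
  have [H [prHK nHB mKH]] := exists_norm_grank_leqS pK pB nKB ntK.
  (* If d(K) > d(G), losing one generator still leaves d(H) >= d(G) for the proper subgroup [H]. *)
  rewrite leqNgt; apply/negP=> ltGK.
  have/minK: gP H.
    rewrite /gP (subset_trans (proper_sub prHK)) // nHB /=.
    by rewrite -ltnS (leq_trans ltGK).
  by move/(_ (proper_sub prHK)) => defH; rewrite defH properxx in prHK.
- apply/(lcn_nil_classP 2 (pgroup_nil pK)).
  exact: (grank_minimal_lcn3 p_pr p_odd pK pB nKB minK').
- by rewrite (grank_minimal_Phi pK nKB minK').
Qed.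

Theorem corollary1p4 (p : nat) (gT aT : finGroupType)
    (G : {group gT}) (A : {group aT}) (to : groupAction A G) :
  prime p -> odd p -> p.-group G -> p.-group A ->
  exists K : {group gT},
    [/\ K \subset G, [acts A, on K | to], 'm(K) = 'm(G),
        nil_class K <= 2 & K^`(1) = 'Phi(K)].
Proof.
move=> p_pr p_odd pG pA.
(* In the semidirect product the action becomes conjugation, so invariance becomes normalisation;
   [K] is pulled back along the injective [inG]. *)
set inG := sdpair1 to; have injG: 'injm inG := injm_sdpair1 to.
set inA := sdpair2 to.
have [|||K [sKG nKA mK clK PhiK]] :=
  @exists_norm_grank_eq_class2 p _ (inG @* G)%G (inA @* A)%G p_pr p_odd.
- by rewrite morphim_pgroup.
- by rewrite morphim_pgroup.
- exact: im_sdpair_norm.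
have sHG: inG @*^-1 K \subset G by apply: subsetIl.
have imH: inG @* (inG @*^-1 K) = K by rewrite morphpreK.
exists (inG @*^-1 K)%G; split=> //=.
- by rewrite actsEsd // imH.
- by rewrite -(injm_grank injG sHG) /= imH mK injm_grank.
- by rewrite (isog_nil_class (sub_isog sHG injG)) /= imH.
- apply: (injm_morphim_inj injG); rewrite ?gFsub_trans //.
  by rewrite morphim_der // (injm_Phi injG) // imH.
Qed.
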